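(* Let $\mathcal{T}$ be an associative conformal algebra, $\mathcal{U}$ a conformal $\mathcal{T}$-bimodule and $H\in C^2_{Hoch}(\mathcal{T},\mathcal{U})$ a Hochschild $2$-cocycle. Let $R:\mathcal{U}\to\mathcal{T}$ be a $\mathbb{C}[\partial]$-linear map. Then $R$ is a conformal $H$-twisted Rota-Baxter operator if and only if $R\in \mathrm{Hom}(\mathcal{U},\mathcal{T})$ is a Maurer-Cartan element in the $L_\infty$-algebra $\big(\bigoplus_{m\ge 0}\mathrm{Hom}(\mathcal{U}^{\otimes m},\mathcal{T}),\llbracket\cdot,\cdot\rrbracket,\llbracket\cdot,\cdot,\cdot\rrbracket\big)$, i.e. if and only if $$\tfrac12\llbracket R,R\rrbracket-\tfrac16\llbracket R,R,R\rrbracket=0 .$$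
   Context: Everything is over $\mathbb{C}$. An associative conformal algebra is a $\mathbb{C}[\partial]$-module $\mathcal{T}$ with a bilinear $\lambda$-product $\mathcal{T}\otimes\mathcal{T}\to\mathcal{T}[\lambda]$, $p\otimes q\mapsto p_\lambda q$, that is conformally sesquilinear ($(\partial p)_\lambda q=-\lambda\,p_\lambda q$, $p_\lambda(\partial q)=(\partial+\lambda)(p_\lambda q)$) and satisfies $(p_\lambda q)_{\lambda+\mu}r=p_\lambda(q_\mu r)$. A conformal $\mathcal{T}$-bimodule is a $\mathbb{C}[\partial]$-module $\mathcal{U}$ with conformally sesquilinear maps $\mathcal{T}\otimes\mathcal{U}\to\mathcal{U}[\lambda]$, $(p,u)\mapsto p_\lambda u$ and $\mathcal{U}\otimes\mathcal{T}\to\mathcal{U}[\lambda]$, $(u,p)\mapsto u_\lambda p$, with $(p_\lambda u)_{\lambda+\mu}q=p_\lambda(u_\mu q)$, $(u_\lambda p)_{\lambda+\mu}q=u_\lambda(p_\mu q)$, $(p_\lambda q)_{\lambda+\mu}u=p_\lambda(q_\mu u)$. A Hochschild $2$-cocycle is a conformally sesquilinear map $H_\lambda:\mathcal{T}\otimes\mathcal{T}\to\mathcal{U}[\lambda]$ with ${p_1}_{\lambda_1}H_{\lambda_2}(p_2,p_3)-H_{\lambda_1+\lambda_2}({p_1}_{\lambda_1}p_2,p_3)+H_{\lambda_1}(p_1,{p_2}_{\lambda_2}p_3)-H_{\lambda_1}(p_1,p_2)_{\lambda_1+\lambda_2}p_3=0$. $\mathbb{C}[\partial]$-linear maps are extended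 coefficientwise to polynomials in $\lambda$. A conformal $H$-twisted Rota-Baxter operator is a $\mathbb{C}[\partial]$-linear map $R:\mathcal{U}\to\mathcal{T}$ with $R(u)_\lambda R(v)=R\big(u_\lambda R(v)+R(u)_\lambda v+H_\lambda(R(u),R(v))\big)$ for all $u,v\in\mathcal{U}$. Cochains. For $\mathbb{C}[\partial]$-modules $V,W$ and $m\ge1$, $\mathrm{Hom}(V^{\otimes m},W)$ is the space of multilinear maps $f_{\lambda_1,\dots,\lambda_{m-1}}:V^{\otimes m}\to W[\lambda_1,\dots,\lambda_{m-1}]$ with $f_{\lambda_1,\dots,\lambda_{m-1}}(x_1,\dots,\partial x_j,\dots,x_m)=-\lambda_jf_{\lambda_1,\dots,\lambda_{m-1}}(x_1,\dots,x_m)$ for $j<m$ and $f_{\lambda_1,\dots,\lambda_{m-1}}(x_1,\dots,\partial x_m)=(\partial+\lambda_1+\dots+\lambda_{m-1})f_{\lambda_1,\dots,\lambda_{m-1}}(x_1,\dots,x_m)$; in particular $\mathrm{Hom}(V,W)$ consists of $\mathbb{C}[\partial]$-linear maps. For $f\in\mathrm{Hom}(V^{\otimes m},V)$, $g\in\mathrm{Hom}(V^{\otimes n},V)$ put $[f,g]_G=f\circ g-(-1)^{(m-1)(n-1)}g\circ f$, $f\circ g=\sum_{i=1}^m(-1)^{(i-1)(n-1)}f\circ_ig$, where $f\circ_i g$ inserts $g$ in the $i$-th slot: $$(f\circ_ig)_{\lambda_1,\dots}(x_1,\dots,x_{m+n-1})=f_{\lambda_1,\dots,\lambda_{i-1},\lambda_i+\dots+\lambda_{i+n-1},\lambda_{i+n},\dots}(x_1,\dots,x_{i-1},g_{\lambda_i,\dots,\lambda_{i+n-2}}(x_i,\dots,x_{i+n-1}),x_{i+n},\dots).$$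 (The parameter of the last of $m$ slots of $f$ is not written.) Brackets. On $\mathcal{T}\oplus\mathcal{U}$ let $\pi=m_c+l+r$ be $\pi_\lambda((p,u),(q,v))=(p_\lambda q,\;p_\lambda v+u_\lambda q)$, and extend elements of $\mathrm{Hom}(\mathcal{U}^{\otimes m},\mathcal{T})$ to $\mathcal{T}\oplus\mathcal{U}$ by zero. For $A\in\mathrm{Hom}(\mathcal{U}^{\otimes a},\mathcal{T})$, $B\in\mathrm{Hom}(\mathcal{U}^{\otimes b},\mathcal{T})$, $C\in\mathrm{Hom}(\mathcal{U}^{\otimes c},\mathcal{T})$ define $$\llbracket A,B\rrbracket=(-1)^a[[\pi,A]_G,B]_G\in\mathrm{Hom}(\mathcal{U}^{\otimes(a+b)},\mathcal{T}),$$ $$A\langle B,C\rangle(u_1,\dots,u_{a+b+c-1})=\sum_{j=1}^a(-1)^{(j-1)b}A\big(u_1,\dots,u_{j-1},H(B(u_j,\dots,u_{j+b-1}),C(u_{j+b},\dots,u_{j+b+c-1})),u_{j+b+c},\dots\big),$$ where the parameters are: $A$ has $\lambda_j+\dots+\lambda_{j+b+c-1}$ in its $j$-th slot and the parameters of the corresponding $u$'s in the other slots, $H$ has parameter $\lambda_j+\dots+\lambda_{j+b-1}$, $B$ has $\lambda_j,\dots,\lambda_{j+b-2}$ and $C$ has $\lambda_{j+b},\dots,\lambda_{j+b+c-2}$; and $$\llbracket A,B,C\rrbracket=(-1)^{abc}\big\{A\langle B,C\rangle-(-1)^{bc}A\langle C,B\rangle-(-1)^{ab}B\langle A,C\rangle+(-1)^{a(b+c)}B\langle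 C,A\rangle-(-1)^{ab+bc+ca}C\langle B,A\rangle+(-1)^{c(a+b)}C\langle A,B\rangle\big\}.$$ The element spaces $\mathrm{Hom}(\mathcal{U}^{\otimes m},\mathcal{T})$ have degree $m$, $\llbracket\cdot,\cdot\rrbracket$ has degree $0$, $\llbracket\cdot,\cdot,\cdot\rrbracket$ has degree $-1$, and all other structure brackets are trivial. A Maurer-Cartan element is an $R\in\mathrm{Hom}(\mathcal{U},\mathcal{T})$ with $\frac12\llbracket R,R\rrbracket-\frac16\llbracket R,R,R\rrbracket=0$. *)

(* Defs.v *)
From HB Require Import structures.
From mathcomp Require Import all_boot all_order all_algebra.
From mathcomp Require Import -(notations) monalg.
From mathcomp Require Import mpoly.

Set Implicit Arguments.
Unset Strict Implicit.
Unset Printing Implicit Defensive.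

Import GRing.Theory.
Local Open Scope ring_scope.

(* [lpoly n W] is W[λ_0, ..., λ_(n-1)]: finitely supported families of elements
   of W indexed by monomials.  When W is an S-module it is a module over
   S[λ_0, ..., λ_(n-1)] = {mpoly S[n]} (instance below). *)
Definition lpoly (S : comNzRingType) (n : nat) (W : lmodType S) : Type :=
  monalg.malg 'X_{1..n} W.

HB.instance Definition _ (S : comNzRingType) (n : nat) (W : lmodType S) :=
  GRing.Zmodule.on (lpoly n W).

Section LPolyCoef.
Variables (S : comNzRingType) (n : nat) (W : lmodType S).

Definition lterm (b : 'X_{1..n}) (w : W) : lpoly n W := monalg.mkmalgU b w.
Definition lcoef (b : 'X_{1..n}) (P : lpoly n W) : W := monalg.mcoeff b P.
Definition lsupp (P : lpoly n W) : seq 'X_{1..n} := finmap.enum_fset (monalg.msupp P).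

End LPolyCoef.

(* Locked (as are the operations below): unfolding it during unification is
   very costly.  The equation lscale.unlock exposes its body. *)
HB.lock Definition lscale (S : comNzRingType) (n : nat) (W : lmodType S)
    (q : {mpoly S[n]}) (P : lpoly n W) : lpoly n W :=
  \sum_(a <- msupp q) \sum_(b <- lsupp P)
     lterm (a + b)%MM (q@_a *: lcoef b P).

Section LPoly.
Variables (S : comNzRingType).
Implicit Types (V W : lmodType S).

Lemma sum_supp_widen (I : eqType) (A : zmodType) (s t : seq I) (F : I -> A) :
  uniq s -> uniq t -> {subset s <= t} -> (forall i, i \notin s -> F i = 0) ->
  \sum_(i <- s) F i = \sum_(i <- t) F i.
Proof.
move=> us ut st F0; rewrite [RHS](bigID (mem s)) /= [X in _ + X]big1 ?addr0;
  last by move=> i /F0.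
rewrite -[RHS]big_filter; apply: perm_big; apply: uniq_perm; rewrite ?filter_uniq //.
by move=> i; rewrite mem_filter; case: (boolP (i \in s)) => // /st ->.
Qed.

Lemma lterm_is_additive n W (b : 'X_{1..n}) : zmod_morphism (@lterm S n W b).
Proof. by move=> x y; rewrite /lterm raddfB. Qed.
HB.instance Definition _ n W (b : 'X_{1..n}) :=
  GRing.isZmodMorphism.Build W (lpoly n W) (@lterm S n W b) (@lterm_is_additive n W b).

Lemma lcoef_is_additive n W (b : 'X_{1..n}) : zmod_morphism (@lcoef S n W b).
Proof. by move=> x y; rewrite /lcoef raddfB. Qed.
HB.instance Definition _ n W (b : 'X_{1..n}) :=
  GRing.isZmodMorphism.Build (lpoly n W) W (@lcoef S n W b) (@lcoef_is_additive n W b).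

Lemma lsupp_uniq n W (P : lpoly n W) : uniq (lsupp P).
Proof. exact: finmap.fset_uniq. Qed.

Lemma lcoef_outdom n W (P : lpoly n W) b : b \notin lsupp P -> lcoef b P = 0.
Proof. by move=> h; apply: monalg.mcoeff_outdom. Qed.

Lemma lsum_additive n W (A : zmodType) (F : 'X_{1..n} -> {additive W -> A})
    (P Q : lpoly n W) :
  \sum_(b <- lsupp (P + Q)) F b (lcoef b (P + Q)) =
  \sum_(b <- lsupp P) F b (lcoef b P) + \sum_(b <- lsupp Q) F b (lcoef b Q).
Proof.
pose t := undup (lsupp (P + Q) ++ lsupp P ++ lsupp Q).
have w (X : lpoly n W) : {subset lsupp X <= t} ->
    \sum_(b <- lsupp X) F b (lcoef b X) = \sum_(b <- t) F b (lcoef b X).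
  move=> h; apply: sum_supp_widen => //; rewrite ?lsupp_uniq ?undup_uniq //.
  by move=> i hi; rewrite lcoef_outdom // raddf0.
rewrite !w; try by move=> b hb; rewrite mem_undup !mem_cat hb ?orbT.
by rewrite -big_split; apply: eq_bigr => b _; rewrite !raddfD.
Qed.

Lemma lsum_term n W (A : zmodType) (F : 'X_{1..n} -> {additive W -> A}) b w :
  \sum_(a <- lsupp (lterm b w)) F a (lcoef a (lterm b w)) = F b w.
Proof.
have c a : lcoef a (lterm b w) = w *+ (b == a) by rewrite /lcoef monalg.mcoeffU.
have [w0|w0] := eqVneq w 0.
  rewrite big1; first by rewrite w0 raddf0.
  by move=> a _; rewrite c w0 mul0rn raddf0.
rewrite (@sum_supp_widen _ _ _ [:: b]) ?lsupp_uniq //.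
- by rewrite big_seq1 c eqxx.
- move=> a; rewrite inE; case: eqP => // /eqP ab.
  rewrite /lsupp -monalg.mcoeff_neq0 -/(lcoef a (lterm b w)) c.
  by rewrite (eq_sym b) (negbTE ab) mulr0n eqxx.
- by move=> a h; rewrite lcoef_outdom ?raddf0.
Qed.

Lemma lpolyE n W (P : lpoly n W) :
  P = \sum_(b <- lsupp P) lterm b (lcoef b P).
Proof. exact: monalg.monalgE. Qed.

Lemma lpoly_ind_add n W (Pr : lpoly n W -> Prop) :
  Pr 0 -> (forall P Q, Pr P -> Pr Q -> Pr (P + Q)) ->
  (forall b w, Pr (lterm b w)) -> forall P, Pr P.
Proof.
by move=> h0 hD hT P; rewrite (lpolyE P); apply: (big_ind Pr) => // b _; apply: hT.
Qed.

Lemma lscaleDr n W q : {morph @lscale S n W q : P Q / P + Q}.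
Proof.
move=> P Q; rewrite lscale.unlock -big_split; apply: eq_bigr => a _.
exact: (lsum_additive (fun b => lterm (a + b)%MM \o *:%R q@_a)).
Qed.

Lemma lscale_widen n W (q : {mpoly S[n]}) (P : lpoly n W) t :
  uniq t -> {subset msupp q <= t} ->
  lscale q P = \sum_(a <- t) \sum_(b <- lsupp P) lterm (a + b)%MM (q@_a *: lcoef b P).
Proof.
move=> ut h; rewrite lscale.unlock; apply: sum_supp_widen => //.
by move=> a /memN_msupp_eq0 ->; rewrite big1 // => b _; rewrite scale0r raddf0.
Qed.

Lemma lscaleDl n W (P : lpoly n W) : {morph @lscale S n W ^~ P : p q / p + q}.
Proof.
move=> p q; pose t := undup (msupp (p + q) ++ msupp p ++ msupp q).
have ut : uniq t by exact: undup_uniq.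
rewrite !(@lscale_widen _ _ _ _ t) //;
  try by move=> b hb; rewrite mem_undup !mem_cat hb ?orbT.
rewrite -big_split; apply: eq_bigr => a _; rewrite -big_split; apply: eq_bigr => b _.
by rewrite mcoeffD scalerDl raddfD.
Qed.

Lemma lscaleXT n W (c : S) a b (w : W) :
  lscale (c *: 'X_[a] : {mpoly S[n]}) (lterm b w) = lterm (a + b)%MM (c *: w).
Proof.
rewrite (@lscale_widen _ _ _ _ [:: a]) //; last first.
  by move=> x /msuppZ_le; rewrite msuppX.
rewrite big_seq1 (lsum_term (fun b => lterm (a + b)%MM \o *:%R _)) /=.
by rewrite mcoeffZ mcoeffX eqxx mulr1.
Qed.

Lemma mpoly_ind_add n (Pr : {mpoly S[n]} -> Prop) :
  (forall p q, Pr p -> Pr q -> Pr (p + q)) ->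
  (forall c a, Pr (c *: 'X_[a])) -> forall p, Pr p.
Proof.
move=> hD hX p; rewrite (mpolyE p); apply: (big_ind Pr) => //.
by rewrite -(scale0r 'X_[0%MM]); apply: hX.
Qed.

Lemma lscale0r n W q : @lscale S n W q 0 = 0.
Proof. by apply: (addrI (lscale q 0)); rewrite -lscaleDr !addr0. Qed.

Lemma lscaleA n W p q (P : lpoly n W) : lscale p (lscale q P) = lscale (p * q) P.
Proof.
elim/lpoly_ind_add: P => [|P Q hP hQ|b w]; first by rewrite !lscale0r.
  by rewrite (lscaleDr q P Q) (lscaleDr p) (lscaleDr (p * q) P Q); congr (_ + _).
elim/mpoly_ind_add: p => [p p' hp hp'|c a].
  by rewrite mulrDl (lscaleDl _ p p') (lscaleDl _ (p * q) (p' * q)); congr (_ + _).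
elim/mpoly_ind_add: q => [q q' hq hq'|d a'].
  rewrite mulrDr (lscaleDl _ q q') (lscaleDr _ (lscale q _)).
  by rewrite (lscaleDl _ (_ * q) (_ * q')); congr (_ + _).
by rewrite -scalerAl -scalerAr -mpolyXD scalerA !lscaleXT scalerA addmA.
Qed.

Lemma lscale1 n W : left_id 1 (@lscale S n W).
Proof.
elim/lpoly_ind_add => [|P Q hP hQ|b w]; first exact: lscale0r.
  by rewrite lscaleDr hP hQ.
by rewrite -mpolyX0 -[X in lscale X]scale1r lscaleXT scale1r add0m.
Qed.

End LPoly.

HB.instance Definition _ (S : comNzRingType) (n : nat) (W : lmodType S) :=
  GRing.Zmodule_isLmodule.Build {mpoly S[n]} (lpoly n W)
    (@lscaleA S n W) (@lscale1 S n W) (@lscaleDr S n W) (fun P => @lscaleDl S n W P).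

Definition lconst (S : comNzRingType) n (W : lmodType S) (w : W) : lpoly n W :=
  lterm 0%MM w.

(* Coefficientwise extension of h : V -> W[λ] to V[λ] -> W[λ]. *)
HB.lock Definition lext (S : comNzRingType) n (V W : lmodType S)
    (h : V -> lpoly n W) (P : lpoly n V) : lpoly n W :=
  \sum_(a <- lsupp P) 'X_[a] *: h (lcoef a P).

(* Substitution of the polynomials σ_i for the variables λ_i. *)
HB.lock Definition lsubst (S : comNzRingType) k n (W : lmodType S)
    (sigma : 'I_k -> {mpoly S[n]}) (P : lpoly k W) : lpoly n W :=
  \sum_(a <- lsupp P) mmap1 sigma a *: lconst n (lcoef a P).

Section LPolyOps.
Variables (S : comNzRingType).
Implicit Types (V W : lmodType S).

Definition lmap n V W (h : V -> W) : lpoly n V -> lpoly n W :=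
  lext (fun v => lconst n (h v)).

(* λ_i + ... + λ_(i+k-1), with variables numbered from 0. *)
Definition lams n (i k : nat) : {mpoly S[n]} := \sum_(j < n | (i <= j < i + k)%N) 'X_j.

(* The product P _s Q for P in V1[λ_0, ..., λ_(n-1)] and Q in
   V2[λ_0, ..., λ_(n-1)], i.e. the value at s of the one parameter of f. *)
Definition lprod_at n V1 V2 W (f : V1 -> V2 -> lpoly 1 W) (s : {mpoly S[n]})
    (P : lpoly n V1) (Q : lpoly n V2) : lpoly n W :=
  lext (fun x => lext (fun y => lsubst (fun=> s) (f x y)) Q) P.

End LPolyOps.

(* A K[∂]-module is an lmodType over {poly K}; ∂ acts as 'X, and c in K as c%:P. *)
Section Conformal.
Variable K : fieldType.
Local Notation dmod := (lmodType {poly K}).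
Local Notation dd := ('X : {poly K}).

Definition scal n (c : K) : {mpoly {poly K}[n]} := c%:P%:MP.

Record conf_sesquilinear (V1 V2 W : dmod) (f : V1 -> V2 -> lpoly 1 W) : Prop :=
  ConfSesquilinear {
    cs_linl : forall (c : K) x x' y, f (c%:P *: x + x') y = scal 1 c *: f x y + f x' y;
    cs_linr : forall (c : K) x y y', f x (c%:P *: y + y') = scal 1 c *: f x y + f x y';
    cs_dl : forall x y, f (dd *: x) y = - 'X_ord0 *: f x y;
    cs_dr : forall x y, f x (dd *: y) = (dd%:MP + 'X_ord0) *: f x y
  }.

(* (x _λ y) _(λ+μ) z = x _λ (y _μ z), with λ = 'X_0 and μ = 'X_1. *)
Definition conf_assoc (V1 V2 V3 V12 V23 W : dmod)
    (f12 : V1 -> V2 -> lpoly 1 V12) (g12 : V12 -> V3 -> lpoly 1 W)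
    (f23 : V2 -> V3 -> lpoly 1 V23) (g23 : V1 -> V23 -> lpoly 1 W) : Prop :=
  forall x y z,
    let lam : {mpoly {poly K}[2]} := 'X_ord0 in
    let mu : {mpoly {poly K}[2]} := 'X_ord_max in
    lprod_at g12 (lam + mu)
      (lprod_at f12 lam (lconst 2 x) (lconst 2 y)) (lconst 2 z) =
    lprod_at g23 lam
      (lconst 2 x) (lprod_at f23 mu (lconst 2 y) (lconst 2 z)).

Record conf_algebra (T : dmod) (mul : T -> T -> lpoly 1 T) : Prop := ConfAlgebra {
  ca_sesq : conf_sesquilinear mul;
  ca_assoc : conf_assoc mul mul mul mul
}.

Record conf_bimodule (T U : dmod) (mul : T -> T -> lpoly 1 T)
    (l : T -> U -> lpoly 1 U) (r : U -> T -> lpoly 1 U) : Prop := ConfBimodule {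
  cb_sesql : conf_sesquilinear l;
  cb_sesqr : conf_sesquilinear r;
  cb_lr : conf_assoc l r r l;
  cb_rr : conf_assoc r r mul r;
  cb_ll : conf_assoc mul l l l
}.

Record hochschild_2cocycle (T U : dmod) (mul : T -> T -> lpoly 1 T)
    (l : T -> U -> lpoly 1 U) (r : U -> T -> lpoly 1 U)
    (H : T -> T -> lpoly 1 U) : Prop := Hochschild2Cocycle {
  hc_sesq : conf_sesquilinear H;
  hc_cocycle : forall p1 p2 p3,
    let lam1 : {mpoly {poly K}[2]} := 'X_ord0 in
    let lam2 : {mpoly {poly K}[2]} := 'X_ord_max in
    let q1 := lconst 2 p1 in let q2 := lconst 2 p2 in let q3 := lconst 2 p3 in
    lprod_at l lam1 q1 (lprod_at H lam2 q2 q3)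
    - lprod_at H (lam1 + lam2) (lprod_at mul lam1 q1 q2) q3
    + lprod_at H lam1 q1 (lprod_at mul lam2 q2 q3)
    - lprod_at r (lam1 + lam2) (lprod_at H lam1 q1 q2) q3 = 0
}.

Definition twisted_RB (T U : dmod) (mul : T -> T -> lpoly 1 T)
    (l : T -> U -> lpoly 1 U) (r : U -> T -> lpoly 1 U)
    (H : T -> T -> lpoly 1 U) (R : {linear U -> T}) : Prop :=
  forall u v : U,
    mul (R u) (R v) = lmap R (r u (R v) + l (R u) v + H (R u) (R v)).

(* Maps V^m -> W[λ_0, ..., λ_(m-2)]; slots and parameters are numbered from 0. *)
Definition cochain (m : nat) (V W : dmod) : Type := m.-tuple V -> lpoly m.-1 W.

Definition tset m (V : Type) (x : m.-tuple V) (j : 'I_m) (y : V) : m.-tuple V :=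
  [tuple if k == j then y else tnth x k | k < m].

(* What ∂ in slot j becomes: -λ_j, or ∂ + λ_0 + ... + λ_(m-2) in the last slot. *)
Definition slot_dd m (j : 'I_m) : {mpoly {poly K}[m.-1]} :=
  if (j < m.-1)%N then - lams _ _ j 1 else dd%:MP + lams _ _ 0 m.-1.

(* Meant for m >= 1. *)
Record is_Hom m (V W : dmod) (f : cochain m V W) : Prop := IsHom {
  hom_lin : forall (x : m.-tuple V) j (c : K) y z,
    f (tset x j (c%:P *: y + z)) = scal _ c *: f (tset x j y) + f (tset x j z);
  hom_dd : forall (x : m.-tuple V) j y,
    f (tset x j (dd *: y)) = slot_dd j *: f (tset x j y)
}.

(* f ∘_(i+1) g.  The arity N is m + n - 1; it is left free so that sums of
   composites whose arities agree only up to commutativity of addition are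
   well typed. *)
Definition insert (N m n : nat) (V W : dmod) (i : nat)
    (f : cochain m V W) (g : cochain n V V) : cochain N V W := fun x =>
  lext (fun y =>
      lsubst (fun j : 'I_m.-1 =>
                if (j < i)%N then lams _ _ j 1
                else if j == i :> nat then lams _ _ i n
                else lams _ _ (j + n.-1) 1)
        (f [tuple if (j < i)%N then x`_j
                  else if j == i :> nat then y
                  else x`_(j + n.-1) | j < m]))
    (lsubst (fun k : 'I_n.-1 => lams _ _ (i + k) 1)
       (g [tuple x`_(i + k) | k < n])).

Definition gcomp (N m n : nat) (V : dmod)
    (f : cochain m V V) (g : cochain n V V) : cochain N V V := fun x =>
  \sum_(i < m) (-1) ^+ (i * n.-1) *: insert i f g x.

Definition gbracket (m n : nat) (V : dmod)
    (f : cochain m V V) (g : cochain n V V) : cochain (m + n).-1 V V := fun x =>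
  gcomp f g x - (-1) ^+ (m.-1 * n.-1) *: gcomp g f x.

Section Brackets.
Variables (T U : dmod).
Variables (mul : T -> T -> lpoly 1 T) (l : T -> U -> lpoly 1 U)
          (r : U -> T -> lpoly 1 U) (H : T -> T -> lpoly 1 U).

Definition inT (p : T) : (T * U)%type := (p, 0).
Definition inU (u : U) : (T * U)%type := (0, u).

Definition pi_prod : cochain 2 (T * U)%type (T * U)%type := fun x =>
  let pu := tnth x ord0 in let qv := tnth x ord_max in
  lmap inT (mul pu.1 qv.1) + lmap inU (l pu.1 qv.2 + r pu.2 qv.1).

Definition extend0 a (A : cochain a U T) : cochain a (T * U)%type (T * U)%type :=
  fun x => lmap inT (A [tuple (tnth x i).2 | i < a]).

(* The derived bracket is again extended by zero from U; it is read off on U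
   by restricting the arguments and projecting to T. *)
Definition bracket2 a b (A : cochain a U T) (B : cochain b U T) :
    cochain (a + b) U T := fun x =>
  lmap fst ((-1) ^+ a *:
    gbracket (gbracket pi_prod (extend0 A)) (extend0 B) [tuple inU (tnth x i) | i < a + b]).

Definition Hpair b c (B : cochain b U T) (C : cochain c U T) : cochain (b + c) U U :=
  fun x =>
  lprod_at H (lams _ _ 0 b)
    (lsubst (fun k : 'I_b.-1 => lams _ _ k 1) (B [tuple x`_k | k < b]))
    (lsubst (fun k : 'I_c.-1 => lams _ _ (b + k) 1) (C [tuple x`_(b + k) | k < c])).

(* A<B,C>; here N stands for a + b + c - 1, as in insert. *)
Definition angle N a b c (A : cochain a U T) (B : cochain b U T) (C : cochain c U T) :
    cochain N U T := fun x =>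
  \sum_(j < a) (-1) ^+ (j * b) *: insert j A (Hpair B C) x.

Definition bracket3 a b c (A : cochain a U T) (B : cochain b U T) (C : cochain c U T) :
    cochain (a + b + c).-1 U T := fun x =>
  (-1) ^+ (a * b * c) *:
    (angle A B C x - (-1) ^+ (b * c) *: angle A C B x
     - (-1) ^+ (a * b) *: angle B A C x + (-1) ^+ (a * (b + c)) *: angle B C A x
     - (-1) ^+ (a * b + b * c + c * a) *: angle C B A x
     + (-1) ^+ (c * (a + b)) *: angle C A B x).

Definition maurer_cartan (R : cochain 1 U T) : Prop :=
  is_Hom R /\
  forall x : 2.-tuple U,
    scal _ 2^-1 *: bracket2 R R x - scal _ 6^-1 *: bracket3 R R R x = 0.

Definition linear_cochain (R : {linear U -> T}) : cochain 1 U T :=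
  fun x => lconst _ (R (thead x)).

End Brackets.
End Conformal.

(* Main.v *)
From HB Require Import structures.
Require Import Defs.
From mathcomp Require Import all_boot all_order all_algebra.
From mathcomp Require Import reals complex.
From mathcomp Require Import mpoly.

(* On the semidirect product of T and U, extend R by zero to the square-zero map
   R' (p, u) = (R u, 0).  Then [π, R'](X, Y) = π(R'X, Y) + π(X, R'Y) - R'π(X, Y),
   and bracketing once more with R' gives, on U,
     [[R, R]] (u, v) = -2 (R(u) R(v) - R(u R(v) + R(u) v)).
   All six terms of [[R, R, R]] carry the same sign, so
     [[R, R, R]] (u, v) = -6 R(H(R(u), R(v))).
   Hence [[R, R]]/2 - [[R, R, R]]/6 is minus the twisted Rota-Baxter defect. *)

Set Implicit Arguments.
Unset Strict Implicit.
Unset Printing Implicit Defensive.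

Import GRing.Theory.
Local Open Scope ring_scope.

(** * Calculus of coefficientwise extension and substitution on λ-polynomials *)

Section LPolyOperations.
Variables (S : comNzRingType).
Implicit Types (V W : lmodType S).

Lemma scale_lterm n W (c : S) a b (w : W) :
  (c *: 'X_[a] : {mpoly S[n]}) *: lterm b w = lterm (a + b)%MM (c *: w).
Proof. exact: lscaleXT. Qed.

Lemma lscaleX_const n W (a : 'X_{1..n}) (w : W) :
  ('X_[a] : {mpoly S[n]}) *: lconst n w = lterm a w.
Proof.
by have := scale_lterm 1 a 0%MM w; rewrite addm0 !scale1r.
Qed.

Lemma lscaleC_const n W (c : S) (w : W) :
  (c%:MP : {mpoly S[n]}) *: lconst n w = lconst n (c *: w).
Proof.
by have := scale_lterm c 0%MM (0%MM : 'X_{1..n}) w; rewrite add0m mpolyX0 -mul_mpolyC mulr1.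
Qed.

Lemma lext_sub n V W (h : V -> lpoly n W) :
  zmod_morphism h -> zmod_morphism (lext h).
Proof.
move=> hh.
(* [lsum_additive] takes bundled additive maps, so [h] is bundled locally; compatibility with sums
   comes first and subtraction follows by cancellation. *)
pose h' : {additive V -> lpoly n W} :=
  HB.pack h (GRing.isZmodMorphism.Build V (lpoly n W) h hh).
have hD P Q : lext h (P + Q) = lext h P + lext h Q.
  by rewrite lext.unlock; exact: (lsum_additive (fun b => ( *:%R 'X_[b]) \o h')).
by move=> P Q; apply: (addIr (lext h Q)); rewrite -hD !subrK.
Qed.

Lemma lext_term n V W (h : V -> lpoly n W) a v :
  zmod_morphism h -> lext h (lterm a v) = 'X_[a] *: h v.
Proof.
move=> hh.
pose h' : {additive V -> lpoly n W} :=
  HB.pack h (GRing.isZmodMorphism.Build V (lpoly n W) h hh).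
by rewrite lext.unlock; exact: (lsum_term (fun b => ( *:%R 'X_[b]) \o h')).
Qed.

Lemma lext_const n V W (h : V -> lpoly n W) v :
  zmod_morphism h -> lext h (lconst n v) = h v.
Proof. by move=> hh; rewrite lext_term // mpolyX0 scale1r. Qed.

Lemma eq_lext n V W (h g : V -> lpoly n W) P : h =1 g -> lext h P = lext g P.
Proof. by move=> e; rewrite lext.unlock; apply: eq_bigr => a _; rewrite e. Qed.

Lemma lconst_sub n W : zmod_morphism (@lconst S n W).
Proof. by move=> x y; rewrite /lconst raddfB. Qed.

Lemma lmap_const_sub n V W (f : V -> W) :
  zmod_morphism f -> zmod_morphism (fun v => lconst n (f v)).
Proof. by move=> hf x y; rewrite hf lconst_sub. Qed.

Lemma lmap_sub n V W (f : V -> W) :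
  zmod_morphism f -> zmod_morphism (@lmap S n V W f).
Proof. by move=> hf; apply/lext_sub/lmap_const_sub. Qed.

Lemma lmapN n V W (f : V -> W) :
  zmod_morphism f -> {morph @lmap S n V W f : P / - P}.
Proof.
move=> hf P; have h := lmap_sub hf.
by rewrite -[X in lmap f X]sub0r h -(subrr P) h subrr sub0r.
Qed.

Lemma lmapD n V W (f : V -> W) :
  zmod_morphism f -> {morph @lmap S n V W f : P Q / P + Q}.
Proof. by move=> hf P Q; rewrite -{1}(opprK Q) lmap_sub // lmapN // opprK. Qed.

Lemma lmap_const n V W (f : V -> W) v :
  zmod_morphism f -> lmap f (lconst n v) = lconst n (f v).
Proof. by move=> hf; rewrite /lmap lext_const //; apply: lmap_const_sub. Qed.

Lemma lmap_id n V : @lmap S n V V id =1 id.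
Proof.
move=> P; rewrite /lmap lext.unlock [RHS]lpolyE.
by apply: eq_bigr => a _; rewrite lscaleX_const.
Qed.

Lemma lmap_comp n V V' W (f : V' -> W) (g : V -> V') P :
  zmod_morphism f -> zmod_morphism g ->
  @lmap S n _ _ f (lmap g P) = lmap (f \o g) P.
Proof.
move=> hf hg; have hfg : zmod_morphism (f \o g) by move=> x y /=; rewrite hg hf.
(* Once bundled, [lmap f] commutes with the finite sum defining [lmap g P], which reduces the claim
   to single monomials. *)
pose F : {additive _ -> _} :=
  HB.pack (@lmap S n _ _ f) (GRing.isZmodMorphism.Build _ _ _ (lmap_sub hf)).
rewrite (_ : lmap f (lmap g P) = F (lmap g P)) // {1}/lmap lext.unlock raddf_sum.
rewrite [RHS]/lmap lext.unlock; apply: eq_bigr => a _.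
rewrite (lscaleX_const a (g _)) (lscaleX_const a ((f \o g) _)) /=.
rewrite /lmap lext_term; last exact: lmap_const_sub.
by rewrite (lscaleX_const a (f _)).
Qed.

Lemma lmap0 n V W (P : lpoly n V) : lmap (fun=> 0 : W) P = 0.
Proof.
rewrite /lmap lext.unlock big1 // => a _.
by rewrite /lconst raddf0 scaler0.
Qed.

Lemma lsubst_term k n W (sigma : 'I_k -> {mpoly S[n]}) a (w : W) :
  lsubst sigma (lterm a w) = mmap1 sigma a *: lconst n w.
Proof.
rewrite lsubst.unlock.
by rewrite (lsum_term (fun b => ( *:%R (mmap1 sigma b)) \o @lterm S n W 0%MM)).
Qed.

Lemma lsubst_const k n W (sigma : 'I_k -> {mpoly S[n]}) (w : W) :
  lsubst sigma (lconst k w) = lconst n w.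
Proof. by rewrite lsubst_term mmap11 scale1r. Qed.

(** In the low arities met below, each substitution in [insert] and [Hpair] either acts on a
    constant or sends every λ_i to itself; this removes the latter kind. *)
Lemma lsubst_id n W (sigma : 'I_n -> {mpoly S[n]}) (P : lpoly n W) :
  (forall i, sigma i = 'X_i) -> lsubst sigma P = P.
Proof.
move=> e; rewrite lsubst.unlock [RHS]lpolyE; apply: eq_bigr => a _.
rewrite (mmap1_eq _ e) mmap1_id; exact: lscaleX_const.
Qed.

Lemma lams_single n (i : 'I_n) : lams S n i 1 = 'X_i.
Proof.
rewrite /lams (big_pred1 i) // => j.
by rewrite addn1 ltnS -eqn_leq eq_sym.
Qed.

End LPolyOperations.

Lemma subr_addACA (Z : zmodType) (a a' b b' c c' : Z) :
  (a - a') + (b - b') - (c - c') = (a + b - c) - (a' + b' - c').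
Proof. by rewrite addrACA -opprD !opprB addrACA [RHS]addrACA; congr (_ + _); rewrite addrC. Qed.

(** Source of the factor 2 in ⟦R,R⟧: [a] stands for R(u)R(v), [b] for R(R(u) v) and [c] for R(u
    R(v)). *)
Lemma subr_double (Z : zmodType) (a b c : Z) :
  a - b + (a - c) - (b + c) = (a - (c + b)) *+ 2.
Proof. by rewrite addrACA -opprD mulr2n [RHS]addrACA addrA (addrC c). Qed.

Definition biadditive (V1 V2 W : zmodType) (f : V1 -> V2 -> W) : Prop :=
  (forall y, zmod_morphism (f^~ y)) /\ (forall x, zmod_morphism (f x)).

(** * Gerstenhaber brackets of a binary cochain with a linear map *)

Section Conformal.
Variable K : fieldType.
Local Notation dmod := (lmodType {poly K}).

Lemma conf_sesquilinear_biadditive (V1 V2 W : dmod) (f : V1 -> V2 -> lpoly 1 W) :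
  conf_sesquilinear f -> biadditive f.
Proof.
(* Taking the scalar -1 in the linearity axioms turns them into compatibility with subtraction. *)
case=> hl hr _ _; have e : scal 1 (-1 : K) = -1 by rewrite /scal !rmorphN1.
split=> [y x x'|x y y'] /=.
  by have := hl (-1) x' x y; rewrite e !rmorphN1 !scaleN1r addrC => ->; rewrite addrC.
by have := hr (-1) x y' y; rewrite e !rmorphN1 !scaleN1r addrC => ->; rewrite addrC.
Qed.

Lemma insert_linear0 (V : dmod) (c : cochain 2 V V) (g : cochain 1 V V) f rho :
  (forall x, c x = f (tnth x ord0) (tnth x ord_max)) ->
  (forall x, g x = lconst _ (rho (tnth x ord0))) ->
  biadditive f ->
  forall x : 2.-tuple V,
  insert 0 c g x = f (rho (tnth x ord0)) (tnth x ord_max) :> lpoly 1 V.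
Proof.
move=> hc hg [hf1 hf2] x; rewrite /insert hg lsubst_const.
rewrite lext_const; last first.
  move=> y z; rewrite !lsubst_id ?hc ?tnth_mktuple //= ?hf1 //;
  by move=> i; rewrite (ord1 i) -lams_single.
rewrite lsubst_id ?hc ?tnth_mktuple //=; last by move=> i; rewrite (ord1 i) -lams_single.
by rewrite !(tnth_nth 0).
Qed.

Lemma insert_linear1 (V : dmod) (c : cochain 2 V V) (g : cochain 1 V V) f rho :
  (forall x, c x = f (tnth x ord0) (tnth x ord_max)) ->
  (forall x, g x = lconst _ (rho (tnth x ord0))) ->
  biadditive f ->
  forall x : 2.-tuple V,
  insert 1 c g x = f (tnth x ord0) (rho (tnth x ord_max)) :> lpoly 1 V.
Proof.
move=> hc hg [hf1 hf2] x; rewrite /insert hg lsubst_const.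
rewrite lext_const; last first.
  move=> y z; rewrite !lsubst_id ?hc ?tnth_mktuple //= ?hf2 //;
  by move=> i; rewrite (ord1 i) -lams_single.
rewrite lsubst_id ?hc ?tnth_mktuple //=; last by move=> i; rewrite (ord1 i) -lams_single.
by rewrite !(tnth_nth 0).
Qed.

(** The only slot of [g] is its last, which carries no parameter, so [rho] just acts on the
    coefficients of [c x]. The target [W] is kept separate from [V] to cover both R' on the sum of T
    and U and R from U to T. *)
Lemma insert_linear_left (V W : dmod) N (c : cochain N.+1 V V)
    (g : cochain 1 V W) rho :
  (forall x, g x = lconst _ (rho (tnth x ord0))) ->
  forall x : N.+1.-tuple V, insert 0 g c x = lmap rho (c x).
Proof.
move=> hg x; rewrite /insert /lmap.
rewrite (eq_lext (g := fun v => lconst _ (rho v))); last first.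
  by move=> y; rewrite hg lsubst_const tnth_mktuple.
congr lext; rewrite lsubst_id; last first.
  by move=> i; rewrite -lams_single.
by congr c; apply: eq_from_tnth => i; rewrite tnth_mktuple (tnth_nth 0).
Qed.

(** Every sign exponent has a zero factor because [g] is unary. The right-hand side is again a
    function of the two arguments, so the lemma can be applied to its own output. *)
Lemma gbracket_linear (V : dmod) (c : cochain 2 V V) (g : cochain 1 V V) f rho :
  (forall x, c x = f (tnth x ord0) (tnth x ord_max)) ->
  (forall x, g x = lconst _ (rho (tnth x ord0))) ->
  biadditive f ->
  forall x, gbracket c g x =
    f (rho (tnth x ord0)) (tnth x ord_max) + f (tnth x ord0) (rho (tnth x ord_max))
    - lmap rho (f (tnth x ord0) (tnth x ord_max)).
Proof.
move=> hc hg hf x; rewrite /gbracket /gcomp !big_ord_recl !big_ord0 /=.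
rewrite !muln0 !expr0 !scale1r !addr0 (insert_linear0 hc hg hf).
by rewrite (insert_linear1 hc hg hf) (insert_linear_left c hg) hc.
Qed.

(** Supplies the biadditivity needed for the second bracketing with the same map. *)
Lemma biadditive_gbracket (V : dmod) (f : V -> V -> lpoly 1 V) rho :
  biadditive f -> zmod_morphism rho ->
  biadditive (fun x y => f (rho x) y + f x (rho y) - lmap rho (f x y)).
Proof.
move=> [h1 h2] hr; split=> [y x x'|x y y'] /=.
  by rewrite hr !h1 (lmap_sub hr); exact: subr_addACA.
by rewrite hr !h2 (lmap_sub hr); exact: subr_addACA.
Qed.

(** * The binary and ternary brackets of R *)

Section Brackets.
Variables (T U : dmod) (mul : T -> T -> lpoly 1 T).
Variables (l : T -> U -> lpoly 1 U) (r : U -> T -> lpoly 1 U).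
Variables (H : T -> T -> lpoly 1 U) (R : {linear U -> T}).
Hypotheses (hmul : biadditive mul) (hl : biadditive l) (hr : biadditive r).
Hypothesis hH : biadditive H.

Lemma inT_sub : zmod_morphism (@inT K T U).
Proof. by move=> x y; congr pair; rewrite subr0. Qed.

Lemma inU_sub : zmod_morphism (@inU K T U).
Proof. by move=> x y; congr pair; rewrite subr0. Qed.

Lemma fst_sub : zmod_morphism (@fst T U). Proof. by []. Qed.

Lemma snd_sub : zmod_morphism (@snd T U). Proof. by []. Qed.

(** The square-zero map R'. *)
Definition lift_linear (X : T * U) : T * U := inT U (R X.2).

Lemma lift_linear_sub : zmod_morphism lift_linear.
Proof. by move=> X Y; rewrite /lift_linear raddfB inT_sub. Qed.

Lemma extend0_linear (x : 1.-tuple (T * U)) :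
  extend0 (linear_cochain R) x = lconst _ (lift_linear (tnth x ord0)).
Proof.
rewrite /extend0 /linear_cochain lmap_const; last exact: inT_sub.
by rewrite /thead tnth_mktuple.
Qed.

(** Curried form of [pi_prod], the shape that [gbracket_linear] expects. *)
Definition semidirect (X Y : T * U) : lpoly 1 (T * U)%type :=
  lmap (@inT K T U) (mul X.1 Y.1) + lmap (@inU K T U) (l X.1 Y.2 + r X.2 Y.1).

Lemma biadditive_semidirect : biadditive semidirect.
Proof.
case: hmul hl hr => [m1 m2] [l1 l2] [r1 r2]; rewrite /semidirect.
split=> [Y X X'|X Y Y'] /=.
  rewrite m1 l1 r1 addrACA -opprD (lmap_sub inT_sub) (lmap_sub inU_sub).
  by rewrite addrACA -opprD.
rewrite m2 l2 r2 addrACA -opprD (lmap_sub inT_sub) (lmap_sub inU_sub).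
by rewrite addrACA -opprD.
Qed.

Lemma lmap_fst_semidirect X Y : lmap fst (semidirect X Y) = mul X.1 Y.1.
Proof.
rewrite lmapD ?(lmap_comp _ fst_sub inT_sub) ?(lmap_comp _ fst_sub inU_sub) //.
by rewrite (lmap_id (mul _ _)) lmap0 addr0.
Qed.

Lemma lmap_snd_semidirect X Y : lmap snd (semidirect X Y) = l X.1 Y.2 + r X.2 Y.1.
Proof.
rewrite lmapD ?(lmap_comp _ snd_sub inT_sub) ?(lmap_comp _ snd_sub inU_sub) //.
by rewrite (lmap_id (_ + _)) lmap0 add0r.
Qed.

Lemma lmap_fst_lift n (P : lpoly n (T * U)%type) :
  lmap fst (lmap lift_linear P) = lmap R (lmap snd P).
Proof.
rewrite !lmap_comp //; [exact: raddfB|exact: lift_linear_sub].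
Qed.

Lemma lmap_snd_lift n (P : lpoly n (T * U)%type) :
  lmap snd (lmap lift_linear P) = 0.
Proof. by rewrite lmap_comp ?lmap0 //; exact: lift_linear_sub. Qed.

Lemma zmod_morphism0 (V W : zmodType) (f : V -> W) : zmod_morphism f -> f 0 = 0.
Proof. by move=> hf; rewrite -(subr0 0) hf subrr. Qed.

(** Closed form of [π, R']. *)
Definition semidirect_bracket (X Y : T * U) : lpoly 1 (T * U)%type :=
  semidirect (lift_linear X) Y + semidirect X (lift_linear Y)
  - lmap lift_linear (semidirect X Y).

Lemma lmap_fst_semidirect_bracket X Y :
  lmap fst (semidirect_bracket X Y) =
  mul (R X.2) Y.1 + mul X.1 (R Y.2) - lmap R (l X.1 Y.2 + r X.2 Y.1).
Proof.
rewrite lmap_sub // lmap_fst_lift lmap_snd_semidirect.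
by rewrite (lmapD fst_sub) !lmap_fst_semidirect.
Qed.

(** R' takes values in T: its outer application has no U-component, and in each of the other two
    terms one of the module actions receives 0 from U. *)
Lemma lmap_snd_semidirect_bracket X Y :
  lmap snd (semidirect_bracket X Y) = l (R X.2) Y.2 + r X.2 (R Y.2).
Proof.
rewrite lmap_sub // lmap_snd_lift subr0 (lmapD snd_sub) !lmap_snd_semidirect /=.
case: hl hr => [_ l2] [r1 _].
rewrite (zmod_morphism0 (r1 _)) addr0; congr (_ + _).
by rewrite (zmod_morphism0 (l2 _)) add0r.
Qed.

Lemma bracket2_linear (x : 2.-tuple U) :
  let u := tnth x ord0 in let v := tnth x ord_max in
  bracket2 mul l r (linear_cochain R) (linear_cochain R) x =
    - ((mul (R u) (R v) - lmap R (r u (R v) + l (R u) v)) *+ 2) :> lpoly 1 T.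
Proof.
move=> u v; rewrite /bracket2 expr1 scaleN1r lmapN //.
have bs := biadditive_semidirect.
have bs' : biadditive semidirect_bracket := biadditive_gbracket bs lift_linear_sub.
have e1 (y : 2.-tuple (T * U)) :
    gbracket (pi_prod mul l r) (extend0 (linear_cochain R)) y =
    semidirect_bracket (tnth y ord0) (tnth y ord_max).
  exact: (gbracket_linear (fun=> erefl) extend0_linear bs).
rewrite (gbracket_linear e1 extend0_linear bs').
rewrite !tnth_mktuple -/u -/v; congr (- _).
rewrite (lmap_sub fst_sub) lmap_fst_lift lmap_snd_semidirect_bracket.
rewrite (lmapD fst_sub (semidirect_bracket _ _)) !lmap_fst_semidirect_bracket /=.
(* The terms that vanish are products of 0 with 0: u and v have no T-component, and their images
   under R' have no U-component. *)
case: hmul hl hr => [_ m2] [_ l2] [_ r2]; rewrite raddf0.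
rewrite (zmod_morphism0 (m2 _)) (zmod_morphism0 (l2 _)) (zmod_morphism0 (r2 _)).
rewrite !addr0 !add0r lmapD; last exact: raddfB.
rewrite lmapD; last exact: raddfB.
exact: subr_double.
Qed.

Lemma bracket3_linear (x : 2.-tuple U) :
  let u := tnth x ord0 in let v := tnth x ord_max in
  bracket3 H (linear_cochain R) (linear_cochain R) (linear_cochain R) x =
    - (lmap R (H (R u) (R v)) *+ 6) :> lpoly 1 T.
Proof.
move=> u v.
have hHp (y : 2.-tuple U) :
    Hpair H (linear_cochain R) (linear_cochain R) y =
    H (R (tnth y ord0)) (R (tnth y ord_max)) :> lpoly 1 U.
  rewrite /Hpair /linear_cochain !lsubst_const /lprod_at /thead !tnth_mktuple /=.
  (* For b = 1 the parameter of H is the single variable λ_0. *)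
  have s1 P : lsubst (fun=> lams {poly K} 1 0 1) P = P :> lpoly 1 U.
    by apply: lsubst_id => i; rewrite (ord1 i) -lams_single.
  case: hH => [h1 h2].
  rewrite lext_const => [|p q]; first rewrite lext_const => [|p q].
  - by rewrite s1 !(tnth_nth 0).
  - by rewrite !s1 h2.
  - by rewrite !lext_const; rewrite ?s1 ?h1 // => p' q'; rewrite !s1 h2.
have hA : angle H (linear_cochain R) (linear_cochain R) (linear_cochain R) x
    = lmap R (H (R u) (R v)) :> lpoly 1 T.
  rewrite /angle big_ord1 mul0n expr0 scale1r.
  rewrite (insert_linear_left (rho := R) (Hpair H (linear_cochain R) (linear_cochain R))) //.
  by rewrite hHp.
(* For a = b = c = 1 the six angle terms coincide. The inner exponents 1, 1, 2, 3, 2 make all of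
   them positive, and the prefactor is -1. *)
rewrite /bracket3 -!hA; move: (angle _ _ _ _ _) => A.
rewrite !muln1 !mul1n !(exprS, expr0, mulr1, mulN1r, opprK).
by rewrite !scaleN1r !scale1r !opprK !mulrS mulr0n addr0 !addrA.
Qed.

End Brackets.

(** * From the brackets to the Maurer-Cartan equation *)

Lemma is_Hom_linear (T U : dmod) (R : {linear U -> T}) : is_Hom (linear_cochain R).
Proof.
split=> [x j c y z|x j y]; rewrite /linear_cochain /thead !tnth_mktuple (ord1 j) eqxx.
  rewrite linearP /lconst raddfD; congr (_ + _).
  by rewrite lscaleC_const.
(* The unique slot is the last one, so [slot_dd] is ∂ plus an empty sum of parameters. *)
rewrite linearZ /slot_dd /= /lams big_ord0 addr0.
by rewrite lscaleC_const.
Qed.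

Lemma scalMn_inv n (W : dmod) m (P : lpoly n W) :
  m%:R != 0 :> K -> scal n (m%:R^-1) *: (P *+ m) = P.
Proof.
move=> hm; rewrite -scaler_nat scalerA.
rewrite (_ : scal n m%:R^-1 * m%:R = 1) ?scale1r //.
have -> : m%:R = scal n (m%:R : K) by rewrite /scal polyC_natr mpolyC_nat.
by rewrite /scal -mpolyCM -polyCM mulVf.
Qed.

End Conformal.

Theorem theorem3p1 (Rr : realType) (T U : lmodType {poly Rr[i]})
    (mul : T -> T -> lpoly 1 T) (l : T -> U -> lpoly 1 U) (r : U -> T -> lpoly 1 U)
    (H : T -> T -> lpoly 1 U)
    (hT : conf_algebra mul) (hU : conf_bimodule mul l r)
    (hH : hochschild_2cocycle mul l r H)
    (R : {linear U -> T}) :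
  twisted_RB mul l r H R <-> maurer_cartan mul l r H (linear_cochain R).
Proof.
have bm := conf_sesquilinear_biadditive (ca_sesq hT).
have bl := conf_sesquilinear_biadditive (cb_sesql hU).
have br := conf_sesquilinear_biadditive (cb_sesqr hU).
have bH := conf_sesquilinear_biadditive (hc_sesq hH).
(* Both implications follow from this identity; characteristic zero lets 1/2 and 1/6 cancel the
   factors 2 and 6. *)
have MC (x : 2.-tuple U) (u := tnth x ord0) (v := tnth x ord_max) :
    scal _ 2^-1 *: bracket2 mul l r (linear_cochain R) (linear_cochain R) x
    - scal _ 6^-1 *: bracket3 H (linear_cochain R) (linear_cochain R) (linear_cochain R) x
    = - (mul (R u) (R v) - lmap R (r u (R v) + l (R u) v + H (R u) (R v))) :> lpoly 1 T.
  rewrite (bracket2_linear R bm bl br) (bracket3_linear R bH) !scalerN.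
  rewrite !scalMn_inv ?Num.Theory.pnatr_eq0 // opprK -/u -/v.
  rewrite [X in _ = - (_ - X)]lmapD; last exact: raddfB.
  by rewrite !opprB addrAC.
split=> [hR|[_ hMC] u v].
  split=> [|x]; first exact: is_Hom_linear.
  by rewrite MC hR subrr oppr0.
have := hMC [tuple u; v]; rewrite MC => /eqP.
by rewrite oppr_eq0 subr_eq0 => /eqP.
Qed.
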